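(* Let $R=(R,+)$ be an upper bound additive monoid. Every almost subtractive submonoid $U$ of $R$ is contained in a maximal almost subtractive submonoid $\widetilde U$ of $R$ (maximal with respect to inclusion among the almost subtractive submonoids of $R$). Moreover, every submonoid of $\widetilde U$ is almost subtractive in $R$.
   Context: Additive monoids are abelian with identity $0$. Write $x\le_R y$ if $x+d=y$ for some $d\in R$; $R$ is upper bound if $\le_R$ is antisymmetric. A submonoid $U$ of $R$ is almost subtractive in $R$ if for all $u,\tilde u\in U$ and $z,z'\in R$ with $u+z=u+z'=\tilde u$ one has $z=z'$. *)

(* Defs.v *)
From mathcomp Require Import all_boot all_algebra.
From mathcomp Require Import boolp classical_sets.

Set Implicit Arguments.
Unset Strict Implicit.
Unset Printing Implicit Defensive.

Import GRing.Theory.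
Local Open Scope classical_set_scope.
Local Open Scope ring_scope.

Definition le_monoid (R : nmodType) (x y : R) : Prop := exists d : R, x + d = y.

Definition upper_bound_monoid (R : nmodType) : Prop :=
  forall x y : R, le_monoid x y -> le_monoid y x -> x = y.

Definition submonoid (R : nmodType) (U : set R) : Prop := Algebra.nmod_closed [in U].

(* Only [u] and the common sum [u'] are required to lie in [U]; the summands
   [z] and [z'] are arbitrary elements of [R]. *)
Definition almost_subtractive (R : nmodType) (U : set R) : Prop :=
  submonoid U /\
  forall u u' z z' : R, u \in U -> u' \in U ->
    u + z = u' -> u + z' = u' -> z = z'.

Definition maximal_almost_subtractive (R : nmodType) (U : set R) : Prop :=
  almost_subtractive U /\
  forall V : set R, almost_subtractive V -> U `<=` V -> V = U.

(* Main.v *)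
Require Import Defs.
From mathcomp Require Import all_boot all_algebra.
From mathcomp Require Import boolp classical_sets.

Set Implicit Arguments.
Unset Strict Implicit.
Unset Printing Implicit Defensive.

Import GRing.Theory.
Local Open Scope classical_set_scope.
Local Open Scope ring_scope.

(** Being almost subtractive is a condition of finite character: apart from containing 0, each
    instance mentions at most two elements of the submonoid, while [z] and [z'] range over all of
    [R]. It therefore survives unions of chains ([almost_subtractive_directed]), so Zorn's lemma
    applies, and it passes to smaller submonoids ([almost_subtractive_sub]). *)

Lemma almost_subtractive_sub (R : nmodType) (U V : set R) :
  almost_subtractive U -> submonoid V -> V `<=` U -> almost_subtractive V.
Proof.
move=> [_ cancelU] subV VU; split=> // u u' z z' /set_mem Vu /set_mem Vu'.
by apply: cancelU; apply/mem_set/VU.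
Qed.

(** Sums and cancellation are each checked inside one [S] holding the two elements involved; a point
    of [W] is needed only to get some [S], hence 0. *)
Lemma almost_subtractive_directed (R : nmodType) (W : set R) :
  (forall x y, W x -> W y -> exists S : set R,
    [/\ almost_subtractive S, S `<=` W, S x & S y]) ->
  W !=set0 -> almost_subtractive W.
Proof.
move=> dirW [w Ww]; split; first split.
- have [S [[[S0 _] _] SW _ _]] := dirW w w Ww Ww.
  exact/mem_set/SW/set_mem.
- move=> x y /set_mem Wx /set_mem Wy.
  have [S [[[_ SD] _] SW Sx Sy]] := dirW x y Wx Wy.
  by apply/mem_set/SW/set_mem/SD; apply/mem_set.
- move=> u u' z z' /set_mem Wu /set_mem Wu'.
  have [S [[_ cancelS] _ Su Su']] := dirW u u' Wu Wu'.
  by apply: cancelS; apply/mem_set.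
Qed.

Theorem corollary1p4 (R : nmodType) (hR : upper_bound_monoid R)
    (U : set R) (hU : almost_subtractive U) :
  exists Ut : set R,
    [/\ U `<=` Ut,
        maximal_almost_subtractive Ut &
        forall V : set R, submonoid V -> V `<=` Ut -> almost_subtractive V].
Proof.
(* The union with [U] makes the empty chain harmless in Zorn's lemma. *)
have [|A [asA maxA]] :=
    @Zorn_bigcup R [set X | almost_subtractive (U `|` X)].
  move=> F FP totF /=.
  apply: almost_subtractive_directed; last first.
    by exists 0; left; apply/set_mem; case: hU => -[].
  have inF X : F X -> U `|` X `<=` U `|` \bigcup_(Y in F) Y.
    by move=> FX; apply: setUS => x Xx; exists X.
  (* The common [S] is [U] itself or [U] joined with the larger chain member involved. *)
  move=> x y [Ux|[X FX Xx]] [Uy|[Y FY Yy]].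
  - by exists U; split=> // z; left.
  - by exists (U `|` Y); split; [exact: FP|exact: inF|left|right].
  - by exists (U `|` X); split; [exact: FP|exact: inF|right|left].
  - have [XY|YX] := totF X Y FX FY.
    + by exists (U `|` Y); split; [exact: FP|exact: inF|right; exact: XY|right].
    + by exists (U `|` X); split; [exact: FP|exact: inF|right|right; exact: YX].
exists (U `|` A); split; first exact: subsetUl.
- split=> // V asV; rewrite subUset => -[UV AV].
  apply/seteqP; split; last by rewrite subUset.
  (* Since [U] lies in [V], [V] itself competes with [A] in the Zorn family, and it would be
     strictly larger. *)
  apply: contrapT => nVUA; apply: (maxA V); last by rewrite /= setUidr.
  by split=> // VA; apply: nVUA => x /VA; right.
- by move=> V; apply: almost_subtractive_sub.
Qed.
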